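(* Let $X$ be a real Banach space and let $Y$ be a closed subspace of $X$. Then the following are equivalent: (1) $Y$ has property-$(wU)$ in $X$. (2) $P_{Y^\perp}(x^* )=\{0\}$ for every $x^*\in X^*$ such that $\|x^*\|=|x^*(y)|$ for some $y\in S_Y$. (3) For any $x_1^*,x_2^*\in X^*$ with $\|x_1^*\|=\|x_2^*\|=|x_1^*(y)|=|x_2^*(y)|$ for some $y\in S_Y$ and $x_1^*+x_2^*\in Y^\perp$, we have $x_1^*+x_2^*=0$.
   Context: $S_Y$ is the unit sphere of $Y$, and $Y^\perp=\{x^*\in X^*: x^*(y)=0\ \forall y\in Y\}$. For $x^*\in X^*$, $P_{Y^\perp}(x^* )=\{z^*\in Y^\perp:\|x^*-z^*\|=d(x^*,Y^\perp)\}$ is the set of best approximations from $x^*$ to $Y^\perp$ (metric projection). $Y$ has property-$(wU)$ in $X$ if every $y^*\in Y^*$ satisfying $\|y^*\|=|y^*(y_0)|$ for some $y_0\in S_Y$ has a unique norm-preserving extension to $X$. *)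

(* Defs.v *)
From HB Require Import structures.
From mathcomp Require Import all_boot all_order all_algebra.
From mathcomp Require Import all_classical all_reals all_analysis.
Set Implicit Arguments.
Unset Strict Implicit.
Unset Printing Implicit Defensive.
Import Order.TTheory GRing.Theory Num.Theory numFieldNormedType.Exports.
Local Open Scope classical_set_scope.
Local Open Scope ring_scope.

Section Dual.
Context {R : realType} (V : normedModType R).

Definition continuous_linear : {pred V -> R^o} :=
  mem [set f : V -> R^o | linear f /\ continuous f].

Lemma continuous_linear_submod_closed : submod_closed continuous_linear.
Proof.
split.
  apply: mem_set; split; last exact: cst_continuous.
  by move=> a u v /=; rewrite scaler0 addr0.
move=> a f g /set_mem[lf cf] /set_mem[lg cg]; apply: mem_set; split.
  move=> b u v.
  change (a *: f (b *: u + v) + g (b *: u + v)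
          = b *: (a *: f u + g u) + (a *: f v + g v)).
  rewrite lf lg !scalerDr !scalerA (mulrC a b).
  by rewrite -!addrA; congr (_ + _); rewrite addrCA.
by move=> x; apply: cvgD; [apply: cvgZl_tmp; exact: cf|exact: cg].
Qed.

HB.instance Definition _ := GRing.isSubmodClosed.Build R _
  continuous_linear continuous_linear_submod_closed.

Record dual_space := DualSpace {
  dual_fun :> V -> R^o ;
  dual_funP : dual_fun \in continuous_linear }.

HB.instance Definition _ := [isSub for dual_fun].
HB.instance Definition _ := [Choice of dual_space by <:].
HB.instance Definition _ := [SubChoice_isSubLmodule of dual_space by <:].

Implicit Types f g : dual_space.

Definition dual_norm f : R := sup [set `|f x| | x in [set x | `|x| <= 1]].

Lemma dual_linear f : linear f.
Proof. by have /set_mem[] := dual_funP f. Qed.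

Lemma dual_continuous f : continuous f.
Proof. by have /set_mem[] := dual_funP f. Qed.

HB.instance Definition _ f :=
  GRing.isLinear.Build R V R^o *:%R (dual_fun f) (dual_linear f).

Lemma dual_norm_has_sup f : has_sup [set `|f x| | x in [set x | `|x| <= 1]].
Proof.
split; first by exists `|f 0|, 0 => //=; rewrite normr0.
have /linear_bounded_continuous/bounded_funP/(_ 1)[M fM] := @dual_continuous f.
by exists M => _ [x /= x1 <-]; exact: fM.
Qed.

Lemma dual_norm_ge f x : `|x| <= 1 -> `|f x| <= dual_norm f.
Proof.
by move=> x1; apply: (ub_le_sup (dual_norm_has_sup f).2); exists x.
Qed.

Lemma dual_norm_le f c :
  (forall x, `|x| <= 1 -> `|f x| <= c) -> dual_norm f <= c.
Proof.
move=> fc; apply: ge_sup; first exact: (dual_norm_has_sup f).1.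
by move=> _ [x /= x1 <-]; exact: fc.
Qed.

Lemma dual_normD f g : dual_norm (f + g) <= dual_norm f + dual_norm g.
Proof.
apply: dual_norm_le => x x1; apply: le_trans (ler_normD _ _) _.
by apply: lerD; exact: dual_norm_ge.
Qed.

Lemma dual_normZ_le a f : dual_norm (a *: f) <= `|a| * dual_norm f.
Proof.
apply: dual_norm_le => x x1.
change (`|a * f x| <= `|a| * dual_norm f).
by rewrite normrM ler_wpM2l// dual_norm_ge.
Qed.

Lemma dual_normZ a f : dual_norm (a *: f) = `|a| * dual_norm f.
Proof.
apply/eqP; rewrite eq_le dual_normZ_le/=.
have [->|a0] := eqVneq a 0.
  rewrite normr0 mul0r; apply: le_trans (dual_norm_ge (x := 0) _ _) => //.
  by rewrite normr0.
rewrite -ler_pdivlMl ?normr_gt0// -normfV.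
by rewrite -[in leLHS](scalerK a0 f) dual_normZ_le.
Qed.

Lemma dual_norm_eq0 f : dual_norm f = 0 -> f = 0.
Proof.
move=> f0; apply/val_inj/funext => x /=; change (f x = 0).
have [->|x0] := eqVneq x 0; first by rewrite linear0.
have : `|f (`|x|^-1 *: x)| <= 0.
  by rewrite -f0 dual_norm_ge// normrZ normfV normr_id mulVf ?normr_eq0.
by rewrite normr_le0 linearZ/= scaler_eq0 invr_eq0 normr_eq0 (negbTE x0)/= => /eqP.
Qed.

HB.instance Definition _ := @Lmodule_isNormed.Build R dual_space
  dual_norm dual_normD dual_normZ dual_norm_eq0.

End Dual.

Section Subspace.
Context {R : realType} {X : normedModType R} (Y : submodClosed X).

(* A subspace as a normed space in its own right, so that `dual_space` also
   applies to it (the library's `subspace` only changes the topology on X). *)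
Record normed_subspace := NormedSubspace {
  subspace_val :> X ;
  subspace_valP : subspace_val \in Y }.

HB.instance Definition _ := [isSub for subspace_val].
HB.instance Definition _ := [Choice of normed_subspace by <:].
HB.instance Definition _ := [SubChoice_isSubLmodule of normed_subspace by <:].

Definition subspace_norm (y : normed_subspace) : R := `|subspace_val y|.

Lemma subspace_normD y z :
  subspace_norm (y + z) <= subspace_norm y + subspace_norm z.
Proof. exact: ler_normD. Qed.

Lemma subspace_normZ a y : subspace_norm (a *: y) = `|a| * subspace_norm y.
Proof. exact: normrZ. Qed.

Lemma subspace_norm_eq0 y : subspace_norm y = 0 -> y = 0.
Proof. by move=> /normr0_eq0 y0; exact: val_inj. Qed.

HB.instance Definition _ := @Lmodule_isNormed.Build R normed_subspace
  subspace_norm subspace_normD subspace_normZ subspace_norm_eq0.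

Definition unit_sphere : set X := [set y | y \in Y /\ `|y| = 1].

Definition annihilator : set (dual_space X) :=
  [set f | forall y, y \in Y -> f y = 0].

Definition norm_preserving_extension
    (g : dual_space normed_subspace) (f : dual_space X) : Prop :=
  (forall y : normed_subspace, f y = g y) /\ `|f| = `|g|.

Definition property_wU : Prop :=
  forall g : dual_space normed_subspace,
    (exists y0 : normed_subspace, unit_sphere y0 /\ `|g| = `|g y0|) ->
    exists! f : dual_space X, norm_preserving_extension g f.

End Subspace.

Definition metric_projection {R : realType} {V : normedModType R}
    (A : set V) (x : V) : set V :=
  [set z | A z /\ (`|x - z|)%:E = edist_inf A x].

(* Main.v *)
From HB Require Import structures.
Require Import Defs.
From mathcomp Require Import all_boot all_order all_algebra.
From mathcomp Require Import all_classical all_reals all_analysis.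
Import Order.TTheory GRing.Theory Num.Theory numFieldNormedType.Exports.
Local Open Scope classical_set_scope.
Local Open Scope ring_scope.

(** For a functional [f] on [X] attaining its norm at some [y] in the unit
    sphere of [Y], every [z] in the annihilator of [Y] satisfies
    [`|f - z| >= `|(f - z) y| = `|f y| = `|f|].  Hence the distance from [f] to
    the annihilator is [`|f|], attained at [0], and [z] is a best
    approximation exactly when [`|f - z| = `|f|]
    ([metric_projection_annihilatorP]).  All three conditions are then readings
    of the same datum, a pair of functionals of equal norm that agree on [Y]
    and attain this norm on the unit sphere of [Y].

    From (1) to (2), the restriction [g] of [f] to [Y] has norm [`|f|] and
    attains it; if [z] is a best approximation, [f] and [f - z] are both
    norm-preserving extensions of [g], so [z = 0].  From (2) to (3), [f1 + f2]
    is a best approximation of [f1], because [f1 - (f1 + f2) = - f2] has the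
    norm of [f1].  From (3) to (1), two norm-preserving extensions [f] and [f']
    of [g] give the pair [f], [- f'], whose sum annihilates [Y]; hence
    [f = f'].

    The only deep ingredient is the existence of a norm-preserving extension in
    (1), that is, the Hahn-Banach theorem.  It is proved in its sublinear form
    ([Hahn_Banach_sublinear]): Zorn's lemma gives a maximal linear relation in
    [V * R] dominated by the sublinear functional, and the one-dimensional
    extension step ([dominated_graph_extend]) shows that it is the graph of a
    functional defined everywhere. *)

(** * The Hahn-Banach theorem *)

Section HahnBanach.
Context {R : realType} {V : lmodType R} (p : V -> R).
Hypothesis pD : forall x y, p (x + y) <= p x + p y.
Hypothesis pZ : forall a x, 0 <= a -> p (a *: x) = a * p x.

(** Partial functionals are encoded as linear subspaces of [V * R^o]: inclusion
    of sets is then extension, unions of chains need no gluing, and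
    single-valuedness follows from domination by [p]
    ([dominated_graph_functional]). *)
Definition dominated_graph (G : set (V * R^o)) : Prop :=
  [/\ G 0, forall (a : R) u v, G u -> G v -> G (a *: u + v) &
      forall u, G u -> u.2 <= p u.1].

(** If [x] is related to [r] and [s], then [0] is related to [r - s] and
    [s - r], which are both at most [p 0 = 0]. *)
Lemma dominated_graph_functional (G : set (V * R^o)) x r s :
  dominated_graph G -> G (x, r) -> G (x, s) -> r = s.
Proof.
move=> [_ Glin Gp].
have le_rs t t' : G (x, t) -> G (x, t') -> t' <= t.
  move=> Gt Gt'; have /Gp := Glin (-1) _ _ Gt Gt'.
  have p0 : p 0 = 0 by rewrite -(scale0r (0 : V)) pZ// mul0r.
  by rewrite /= !scaleN1r addNr p0 addrC subr_le0.
by move=> Gr Gs; apply/eqP; rewrite eq_le !le_rs.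
Qed.

(** Any such [c] can serve as the value at [z] of an extension: the two families
    of inequalities are the domination by [p] at [x - z] and at [x + z].  They
    are compatible because
    [s + r <= p (y + x) <= p (y - z) + p (x + z)] whenever [(y, s)] and [(x, r)]
    are in [G]; so [c] can be the supremum of the lower bounds. *)
Lemma dominated_graph_gap (G : set (V * R^o)) (z : V) : dominated_graph G ->
  exists c : R, (forall x r, G (x, r) -> r - p (x - z) <= c) /\
                (forall x r, G (x, r) -> c <= p (x + z) - r).
Proof.
move=> [G0 Glin Gp].
pose A := [set u.2 - p (u.1 - z) | u in G].
have A_ub x r : G (x, r) -> ubound A (p (x + z) - r).
  move=> Gxr _ [[y s] Gys <-] /=.
  have := Gp _ (Glin 1 _ _ Gys Gxr); rewrite /= !scale1r => sr_le.
  have := pD (y - z) (x + z); rewrite addrACA addNr addr0 => pyx.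
  by rewrite lerBlDr addrAC lerBrDr (le_trans sr_le)// (le_trans pyx)// addrC.
exists (sup A); split => x r Gxr.
  by apply: ub_le_sup; [exists (p (0 + z) - 0); exact: A_ub|exists (x, r)].
by apply: ge_sup; [exists (0 - p (0 - z)), (0, 0)|exact: A_ub].
Qed.

(** Add the line through [(z, c)], with [c] as in [dominated_graph_gap].
    Domination at [x + a *: z] reduces, after division by [`|a|], to the
    inequality defining [c] on the side given by the sign of [a]. *)
Lemma dominated_graph_extend (G : set (V * R^o)) (z : V) :
  dominated_graph G ->
  exists G' : set (V * R^o),
    [/\ dominated_graph G', G `<=` G' & exists r, G' (z, r)].
Proof.
move=> domG; have [c [c_ge c_le]] := dominated_graph_gap G z domG.
have [G0 Glin Gp] := domG.
have GZ a x r : G (x, r) -> G (a *: x, a * r).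
  by move=> Gxr; have := Glin a _ _ Gxr G0; rewrite addr0.
exists [set w |
  exists2 u, G u & exists a : R, w = u + a *: (z, c : R^o)]; split.
- split.
  + by exists 0 => //; exists 0; rewrite scale0r addr0.
  + move=> a _ _ [u Gu [b ->]] [v Gv [d ->]].
    exists (a *: u + v); first exact: Glin.
    by exists (a * b + d); rewrite scalerDr scalerDl scalerA addrACA.
  + move=> _ [[x r] Gxr [a ->]] /=; rewrite -[a *: (c : R^o)]/(a * c).
    have [a0|a0|->] := ltgtP a 0; last 1 first.
      by rewrite scale0r mul0r !addr0; exact: (Gp _ Gxr).
    * have b0 : 0 < - a by rewrite oppr_gt0.
      have /c_ge := GZ (- a)^-1 _ _ Gxr.
      rewrite lerBlDr -lerBlDl => /(ler_wpM2l (ltW b0)).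
      rewrite -pZ; last exact: ltW.
      rewrite scalerBr scalerA divff ?gt_eqF// scale1r scaleNr opprK.
      rewrite mulrBr mulrA divff ?gt_eqF// mul1r.
      by rewrite mulNr opprK.
    * have /c_le := GZ a^-1 _ _ Gxr.
      rewrite lerBrDr => /(ler_wpM2l (ltW a0)).
      rewrite -pZ; last exact: ltW.
      rewrite scalerDr scalerA divff ?gt_eqF// scale1r.
      rewrite mulrDr mulrA divff ?gt_eqF// mul1r.
      by rewrite addrC.
- by move=> u Gu; exists u => //; exists 0; rewrite scale0r addr0.
- by exists c, 0 => //; exists 1; rewrite scale1r add0r.
Qed.

(** A maximal dominated graph containing [G0] is total: by maximality it equals
    any of its one-dimensional extensions. *)
Lemma dominated_graph_total (G0 : set (V * R^o)) : dominated_graph G0 ->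
  exists G, [/\ dominated_graph G, G0 `<=` G & forall x, exists r, G (x, r)].
Proof.
move=> domG0; have [G00 G0lin G0p] := domG0.
(* Zorn_bigcup also covers the empty chain, whose union is empty; adjoining G0
   to every set makes the empty set admissible. *)
have [] := @Zorn_bigcup _ [set A | dominated_graph (G0 `|` A)].
  move=> F Fdom Ftot; split => /=.
  - by left.
  - move=> a u v [Gu|[A FA Au]] [Gv|[B FB Bv]].
    + by left; exact: G0lin.
    + have [_ /(_ a u v)[]//] := Fdom _ FB; [by left|by right|by left|].
      by right; exists B.
    + have [_ /(_ a u v)[]//] := Fdom _ FA; [by right|by left|by left|].
      by right; exists A.
    + have [AB|BA] := Ftot _ _ FA FB.
      * have [_ /(_ a u v)[]//] := Fdom _ FB;
          [by right; exact: AB|by right|by left|].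
        by right; exists B.
      * have [_ /(_ a u v)[]//] := Fdom _ FA;
          [by right|by right; exact: BA|by left|].
        by right; exists A.
  - by move=> u [/G0p//|[A FA Au]]; have [_ _] := Fdom _ FA; apply; right.
move=> A [domA maxA]; exists (G0 `|` A); split => // x.
have [G' [domG' AG' [r G'xr]]] := dominated_graph_extend _ x domA.
exists r; apply: contrapT => nAxr; apply: (maxA G'); last first.
  by rewrite /= setUidr//; apply: subset_trans AG'; exact: subsetUl.
split; first by apply: subset_trans AG'; exact: subsetUr.
by move=> G'A; apply: nAxr; right; exact: G'A.
Qed.

(** The subspace is the image of a linear map [i], and [f] lives on its source.
    Domination by [p] forces [f] to vanish on the kernel of [i], so [f] factors
    through this image. *)
Theorem Hahn_Banach_sublinear (W : lmodType R) (i : {linear W -> V})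
    (f : {linear W -> R^o}) :
  (forall w, f w <= p (i w)) ->
  exists F : {linear V -> R^o},
    (forall w, F (i w) = f w) /\ forall x, F x <= p x.
Proof.
move=> fp.
have [|G [domG fG Gtot]] := @dominated_graph_total [set (i w, f w) | w in setT].
  split; first by exists 0 => //; rewrite !linear0.
    by move=> a _ _ [u _ <-] [v _ <-]; exists (a *: u + v); rewrite // !linearP.
  by move=> _ [w _ <-] /=.
have [_ Glin Gp] := domG.
have [F GF] := choice Gtot.
have Flin : linear F.
  move=> a x y; apply: (dominated_graph_functional G _ _ _ domG (GF _)).
  exact: (Glin a _ _ (GF x) (GF y)).
pose FL := GRing.isLinear.Build R V R^o *:%R F Flin.
pose F' : {linear V -> R^o} := HB.pack F FL.
exists F'; split => [w|x]; last exact: (Gp _ (GF x)).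
by apply: (dominated_graph_functional G _ _ _ domG (GF _)); apply: fG; exists w.
Qed.

End HahnBanach.

(** * Functionals and their norms *)

Section DualSpace.
Context {R : realType} {V : normedModType R}.
Implicit Types f g : dual_space V.

Lemma dual_norm_bound f x : `|f x| <= `|f| * `|x|.
Proof.
have [->|x0] := eqVneq x 0; first by rewrite linear0 !normr0 mulr0.
rewrite -ler_pdivrMr ?normr_gt0//.
have -> : `|f x| / `|x| = `|f (`|x|^-1 *: x)|.
  by rewrite linearZ normrZ normfV normr_id mulrC.
by apply: dual_norm_ge; rewrite normrZ normfV normr_id mulVf ?normr_eq0.
Qed.

Lemma dual_norm_bound_le f (c : R) :
  0 <= c -> (forall x, `|f x| <= c * `|x|) -> `|f| <= c.
Proof.
move=> c0 fc; apply: dual_norm_le => x x1.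
by apply: le_trans (fc x) _; rewrite ler_piMr.
Qed.

Lemma bounded_linear_dual (F : {linear V -> R^o}) (c : R) :
  (forall x, `|F x| <= c * `|x|) -> exists f, forall x, f x = F x.
Proof.
move=> Fc.
have FP : (F : V -> R^o) \in @continuous_linear R V.
  apply: mem_set; split; first exact: linearP.
  apply/linear_bounded_continuous/bounded_funP => r.
  exists (`|c| * r) => x xr; apply: le_trans (Fc x) _.
  by apply: le_trans (ler_wpM2r _ (ler_norm c)) _ => //; exact: ler_wpM2l.
by exists (DualSpace FP).
Qed.

End DualSpace.

(** * Norm-preserving extensions *)

Section Extension.
Context {R : realType} {X : normedModType R} (Y : submodClosed X).

Lemma dual_norm_ge_sphere (f : dual_space X) y :
  unit_sphere Y y -> `|f y| <= `|f|.
Proof.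
by move=> [_ y1]; rewrite (le_trans (dual_norm_bound _ _))// y1 mulr1.
Qed.

(** The sublinear Hahn-Banach theorem for [x |-> `|g| * `|x|]. *)
Lemma Hahn_Banach_extension (g : dual_space (normed_subspace Y)) :
  exists f : dual_space X, norm_preserving_extension g f.
Proof.
pose p (x : X) : R := `|g| * `|x|.
have pD x y : p (x + y) <= p x + p y.
  by rewrite /p -mulrDr ler_wpM2l// ler_normD.
have pZ a x : 0 <= a -> p (a *: x) = a * p x.
  by move=> a0; rewrite /p normrZ ger0_norm// mulrCA.
have [y|F [Fg Fp]] := Hahn_Banach_sublinear p pD pZ _
  (val : {linear normed_subspace Y -> X}) (g : {linear _ -> _}).
  exact: le_trans (ler_norm _) (dual_norm_bound _ _).
(* As p is even, a linear F below p is bounded by p in absolute value. *)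
have Fbound x : `|F x| <= `|g| * `|x|.
  rewrite ler_norml Fp andbT lerNl -raddfN.
  by apply: le_trans (Fp _) _; rewrite /p normrN.
have [f fF] := bounded_linear_dual F _ Fbound.
exists f; split=> [y|]; first by rewrite fF -Fg.
apply/eqP; rewrite eq_le !dual_norm_bound_le// => [y|x]; last by rewrite fF.
have -> : g y = f y by rewrite fF -Fg.
exact: dual_norm_bound.
Qed.

Lemma dual_restriction (f : dual_space X) :
  exists g : dual_space (normed_subspace Y),
    forall y : normed_subspace Y, g y = f y.
Proof.
have [|g gf] := bounded_linear_dual
  (f \o (val : {linear normed_subspace Y -> X})) `|f|.
  by move=> y; exact: dual_norm_bound.
by exists g.
Qed.

(** * Best approximation from the annihilator *)

(** [edist] is the infimum of the radii of the balls around [x] containing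
    [y]; in a normed space those are the [r > `|x - y|]. *)
Lemma edist_norm (W : normedModType R) (x y : W) :
  edist (x, y) = `|x - y|%:E.
Proof.
apply/eqP; rewrite eq_le; apply/andP; split.
  apply/lee_addgt0Pr => e e0; apply: edist_fin.
    by rewrite ltr_wpDl.
  by rewrite -ball_normE /ball_ /= ltrDl.
apply: le_ereal_inf_tmp => _ [r [r0 xyr] <-]; rewrite lee_fin ltW//.
by move: xyr; rewrite -ball_normE.
Qed.

(** Subtracting a functional that vanishes at [y] cannot bring the norm of [f]
    below [`|f y|], so the distance from [f] to the annihilator is [`|f|]. *)
Lemma metric_projection_annihilatorP (f : dual_space X) y :
  unit_sphere Y y -> `|f| = `|f y| ->
  forall z, metric_projection (annihilator Y) f z <->
    annihilator Y z /\ `|f - z| = `|f|.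
Proof.
move=> Sy fy.
have annB z : annihilator Y z -> `|f| <= `|f - z|.
  move=> zY; rewrite fy.
  have -> : f y = (f - z) y.
    by change (f y = f y - z y); rewrite zY ?subr0//; case: Sy.
  exact: dual_norm_ge_sphere.
have -> : metric_projection (annihilator Y) f =
    [set z | annihilator Y z /\ (`|f - z|)%:E = `|f|%:E].
  rewrite /metric_projection.
  suff -> : edist_inf (annihilator Y) f = `|f|%:E by [].
  apply/eqP; rewrite eq_le; apply/andP; split.
    apply: ereal_inf_lbound; exists 0; first by [].
    by rewrite edist_norm subr0.
  by apply: le_ereal_inf_tmp => _ [z zY <-]; rewrite edist_norm lee_fin annB.
by move=> z; split=> -[zY fz]; split=> //; [case: fz|congr EFin].
Qed.

End Extension.

Theorem theorem2p1 (R : realType) (X : completeNormedModType R)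
    (Y : submodClosed X) (closedY : closed [set y : X | y \in Y]) :
  [<-> property_wU Y ;
       forall f : dual_space X,
         (exists y : X, unit_sphere Y y /\ `|f| = `|f y|) ->
         metric_projection (annihilator Y) f = [set 0] ;
       forall f1 f2 : dual_space X,
         (exists y : X, [/\ unit_sphere Y y, `|f1| = `|f2|,
                            `|f2| = `|f1 y| & `|f1 y| = `|f2 y|]) ->
         annihilator Y (f1 + f2) ->
         f1 + f2 = 0].
Proof.
tfae.
- move=> wU f [y [Sy fy]].
  have [g gf] := dual_restriction Y f.
  pose y0 : normed_subspace Y := NormedSubspace Sy.1.
  have gy : `|g y0| = `|f| by rewrite gf -fy.
  have norm_g : `|f| = `|g|.
    apply/le_anti/andP; split.
      rewrite -gy (le_trans (dual_norm_bound _ _))//.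
      have -> : `|y0| = 1 by exact: Sy.2.
      by rewrite mulr1.
    apply: dual_norm_bound_le => // x.
    by rewrite gf; exact: dual_norm_bound.
  have [|h [_ h_uniq]] := wU g; first by exists y0; rewrite gy norm_g.
  apply/seteqP; split=> z;
    rewrite (metric_projection_annihilatorP _ _ _ Sy fy)/=.
    move=> [zY fz].
    have h_fz : h = f - z.
      apply: h_uniq; split; last by rewrite fz.
      move=> x; rewrite gf; change (f x - z x = f x).
      by rewrite zY ?subr0//; exact: subspace_valP.
    have h_f : h = f by apply: h_uniq; split => // x; rewrite gf.
    by apply/eqP; rewrite -oppr_eq0 -(inj_eq (addrI f)) addr0 -h_fz h_f.
  by move=> ->; rewrite subr0.
- move=> proj f1 f2 [y [Sy f12 f2y f1y]] f12Y.
  have f1E : `|f1| = `|f1 y| by rewrite f12.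
  have : metric_projection (annihilator Y) f1 (f1 + f2).
    apply/(metric_projection_annihilatorP _ _ _ Sy f1E); split => //.
    by rewrite opprD addNKr normrN.
  by rewrite proj//; exists y.
- move=> anti g [y0 [Sy0 gy0]].
  have [f [fg norm_f]] := Hahn_Banach_extension Y g.
  exists f; split => // f' [f'g norm_f'].
  apply/eqP; rewrite -subr_eq0; apply/eqP; apply: anti.
    exists (subspace_val y0); split => //.
    + by rewrite normrN norm_f norm_f'.
    + by rewrite normrN norm_f' gy0 fg.
    + by change (`|f y0| = `|- f' y0|); rewrite normrN fg f'g.
  move=> y yY; change (f y - f' y = 0).
  have := fg (NormedSubspace yY); have := f'g (NormedSubspace yY).
  by move=> /= -> ->; rewrite subrr.
Qed.
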